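(* For each fixed $x\in\mathbb{R}$, as $c\to 0^+$, $$x\tanh\left(\frac{x}{c}\right)-|x|=o\left(\sqrt{x^2+c^2}-|x|\right),$$ that is, $$\lim_{c\to 0^+}\frac{x\tanh\left(\frac{x}{c}\right)-|x|}{\sqrt{x^2+c^2}-|x|}=0.$$ *)

(* Defs.v *)
From Stdlib Require Export Reals.
From Coquelicot Require Export Coquelicot.

(* Main.v *)
Require Import Defs.
From Stdlib Require Import Reals Lra.
From Coquelicot Require Import Coquelicot.
Open Scope R_scope.

(** For [x <> 0] the numerator is exponentially small in [1 / c], while the
    denominator [sqrt (x ^ 2 + c ^ 2) - |x|] is of order [c ^ 2]; for [x = 0]
    the numerator vanishes identically.  Crude forms of both facts suffice.
    Writing [a = |x|] and using that [u * tanh u] is even, the numerator is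
    [- a * (1 - tanh (a / c))], and [1 - tanh u = 2 / (exp (2 * u) + 1)] is
    at most [27 / (4 * u ^ 3)] for [u > 0], so the numerator is [O(c ^ 3)]
    ([one_sub_tanh_bounds]).  The denominator is at least [c ^ 2 / (3 * a)] as
    soon as [c <= a] ([sqrt_sub_lower_bound]).  Hence the numerator is bounded by
    [K * c] times the denominator in absolute value ([tanh_error_le]), which gives both forms of
    the conclusion. *)

Lemma one_sub_tanh (u : R) : 1 - tanh u = 2 / (exp (2 * u) + 1).
Proof.
unfold tanh, sinh, cosh.
replace (2 * u) with (u + u) by ring.
rewrite exp_plus, exp_Ropp.
pose proof (exp_pos u) as He.
field; repeat split; nra.
Qed.

(** The upper bound comes from [exp (2 * u) = exp (2 * u / 3) ^ 3]
    and [exp y >= y]; any power of [1 / u] above the second would do below. *)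
Lemma one_sub_tanh_bounds (u : R) :
  0 < u -> 0 <= 1 - tanh u <= 27 / (4 * u ^ 3).
Proof.
intros Hu.
rewrite one_sub_tanh.
assert (Hcube : exp (2 * u) = exp (2 * u / 3) ^ 3).
{ replace (2 * u) with (2 * u / 3 + (2 * u / 3 + 2 * u / 3)) at 1 by field.
  rewrite !exp_plus; ring. }
assert (Hpow : (2 * u / 3) ^ 3 <= exp (2 * u)).
{ rewrite Hcube; apply pow_incr.
  pose proof (exp_ineq1_le (2 * u / 3)); lra. }
assert (Hu3 : 0 < u ^ 3) by (apply pow_lt; exact Hu).
pose proof (exp_pos (2 * u)) as He.
split.
- apply Rlt_le, Rdiv_lt_0_compat; lra.
- replace (27 / (4 * u ^ 3)) with (2 / ((2 * u / 3) ^ 3)) by (field; lra).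
  apply Rmult_le_compat_l; [lra|].
  apply Rinv_le_contravar; [apply pow_lt|]; lra.
Qed.

Lemma mul_tanh_abs (x c : R) :
  x * tanh (x / c) = Rabs x * tanh (Rabs x / c).
Proof.
unfold Rabs; destruct (Rcase_abs x); [|reflexivity].
replace (- x / c) with (- (x / c)) by (unfold Rdiv; ring).
unfold tanh, sinh, cosh; rewrite Ropp_involutive.
pose proof (exp_pos (x / c)); pose proof (exp_pos (- (x / c))).
field; lra.
Qed.

Lemma sqrt_sub_pos (x c : R) : 0 < c -> 0 < sqrt (x ^ 2 + c ^ 2) - Rabs x.
Proof.
intros Hc.
apply Rlt_0_minus.
rewrite <- (sqrt_Rsqr_abs x).
apply sqrt_lt_1; unfold Rsqr; nra.
Qed.

Lemma sqrt_sub_lower_bound (x c : R) :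
  0 < c <= Rabs x ->
  c ^ 2 / (3 * Rabs x) <= sqrt (x ^ 2 + c ^ 2) - Rabs x.
Proof.
intros Hc.
pose proof (sqrt_sub_pos x c (proj1 Hc)) as HD.
rewrite <- (pow2_abs x) in *.
set (a := Rabs x) in *.
assert (Hs : sqrt (a ^ 2 + c ^ 2) * sqrt (a ^ 2 + c ^ 2) = a ^ 2 + c ^ 2)
  by (apply sqrt_sqrt; nra).
set (s := sqrt (a ^ 2 + c ^ 2)) in *.
assert (s <= 2 * a) by nra.
apply Rle_div_l; [lra|].
(* c ^ 2 = (s - a) * (s + a), and s + a <= 3 * a. *)
nra.
Qed.

Lemma tanh_error_le (x : R) :
  exists K d : R, 0 < K /\ 0 < d /\
    forall c, 0 < c < d ->
      Rabs (x * tanh (x / c) - Rabs x)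
        <= K * c * (sqrt (x ^ 2 + c ^ 2) - Rabs x).
Proof.
destruct (Req_dec x 0) as [Hx|Hx].
- exists 1, 1; split; [lra|split; [lra|]].
  intros c Hc.
  pose proof (sqrt_sub_pos x c (proj1 Hc)).
  replace (x * tanh (x / c) - Rabs x) with 0
    by (rewrite Hx, Rabs_R0; ring).
  rewrite Rabs_R0; nra.
- pose proof (Rabs_pos_lt x Hx) as Ha.
  exists (81 / (4 * Rabs x)), (Rabs x).
  assert (HK : 0 < 81 / (4 * Rabs x)) by (apply Rdiv_lt_0_compat; lra).
  split; [exact HK|split; [exact Ha|]].
  intros c Hc.
  assert (HD : c ^ 2 / (3 * Rabs x) <= sqrt (x ^ 2 + c ^ 2) - Rabs x)
    by (apply sqrt_sub_lower_bound; lra).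
  rewrite mul_tanh_abs.
  destruct (one_sub_tanh_bounds (Rabs x / c)) as [Ht0 Ht1];
    [apply Rdiv_lt_0_compat; lra|].
  rewrite Rabs_left1 by nra.
  apply Rle_trans with (Rabs x * (27 / (4 * (Rabs x / c) ^ 3))); [nra|].
  replace (Rabs x * (27 / (4 * (Rabs x / c) ^ 3)))
    with (81 / (4 * Rabs x) * c * (c ^ 2 / (3 * Rabs x))) by (field; lra).
  apply Rmult_le_compat_l; [|exact HD].
  apply Rmult_le_pos; lra.
Qed.

Lemma tanh_error_eventually_le (x eps : R) :
  0 < eps ->
  at_right 0 (fun c =>
    0 < c /\
    Rabs (x * tanh (x / c) - Rabs x)
      <= eps * (sqrt (x ^ 2 + c ^ 2) - Rabs x)).
Proof.
intros Heps.
destruct (tanh_error_le x) as [K [d [HK [Hd Hle]]]].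
assert (Hr : 0 < Rmin d (eps / K))
  by (apply Rmin_pos; [|apply Rdiv_lt_0_compat]; lra).
exists (mkposreal _ Hr); intros c Hball Hc.
split; [exact Hc|].
change (Rabs (c - 0) < Rmin d (eps / K)) in Hball.
rewrite Rabs_pos_eq in Hball by lra.
pose proof (Rmin_l d (eps / K)); pose proof (Rmin_r d (eps / K)).
apply Rle_trans with (K * c * (sqrt (x ^ 2 + c ^ 2) - Rabs x));
  [apply Hle; lra|].
apply Rmult_le_compat_r; [apply Rlt_le, sqrt_sub_pos, Hc|].
rewrite Rmult_comm; apply Rle_div_r; lra.
Qed.

(* In Coquelicot, [is_domin F f g] reads "g = o(f) along the filter F". *)
Theorem theorem2p2 :
  forall x : R,
    is_domin (at_right 0)
      (fun c : R => sqrt (x ^ 2 + c ^ 2) - Rabs x)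
      (fun c : R => x * tanh (x / c) - Rabs x)
    /\
    filterlim
      (fun c : R =>
         (x * tanh (x / c) - Rabs x) / (sqrt (x ^ 2 + c ^ 2) - Rabs x))
      (at_right 0) (locally 0).
Proof.
intros x; split.
- intros eps.
  generalize (tanh_error_eventually_le x eps (cond_pos eps)).
  apply filter_imp; intros c [Hc Hle].
  change (Rabs (x * tanh (x / c) - Rabs x)
            <= eps * Rabs (sqrt (x ^ 2 + c ^ 2) - Rabs x)).
  rewrite (Rabs_pos_eq (sqrt _ - _)) by apply Rlt_le, sqrt_sub_pos, Hc.
  exact Hle.
- apply filterlim_locally; intros eps.
  pose proof (cond_pos eps) as Heps.
  (* The distance to the limit must be strictly below eps. *)
  generalize (tanh_error_eventually_le x (eps / 2) ltac:(lra)).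
  apply filter_imp; intros c [Hc Hle].
  pose proof (sqrt_sub_pos x c Hc) as HD.
  change (Rabs ((x * tanh (x / c) - Rabs x)
                  / (sqrt (x ^ 2 + c ^ 2) - Rabs x) - 0) < eps).
  rewrite Rminus_0_r, Rabs_div, (Rabs_pos_eq (sqrt _ - _)) by lra.
  apply Rlt_div_l; [exact HD|nra].
Qed.
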